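(* Let $X$ be a Banach space and let $\{\mathfrak{s}_n : n\in\omega\}$ be a countable family of projectional skeletons on $X$ inducing the same set $D\subset X^*$ (that is, $D(\mathfrak{s}_n)=D$ for every $n\in\omega$). Then there exists a simple projectional skeleton on $X$ which is isomorphic to a subskeleton of $\mathfrak{s}_n$, for every $n\in\omega$.
   Context: All projections are bounded linear idempotent maps $X\to X$. Let $(\Gamma,\le)$ be an up-directed partially ordered set. A sequence $(s_n)_{n\in\omega}$ in $\Gamma$ is increasing if $s_n\le s_{n+1}$ for all $n$. $\Gamma$ is $\sigma$-complete if every increasing sequence in $\Gamma$ has a supremum in $\Gamma$; then $\Gamma'\subset\Gamma$ is $\sigma$-closed in $\Gamma$ if $\sup_n s_n\in\Gamma'$ for every increasing sequence $(s_n)$ in $\Gamma'$. A projectional skeleton on $X$ is a family of bounded linear projections $\mathfrak{s}=(P_s)_{s\in\Gamma}$ on $X$ indexed by an up-directed $\sigma$-complete partially ordered set $\Gamma$ such that: (1) $P_s[X]$ is separable for every $s$; (2) if $s\le t$ then $P_s=P_s\circ P_t=P_t\circ P_s$; (3) if $(s_n)$ is increasing with $s=\sup_n s_n$, then $P_s[X]=\overline{\bigcup_n P_{s_n}[X]}$; (4) $X=\bigcup_{s\in\Gamma}P_s[X]$. The set induced by $\mathfrak{s}$ is $D(\mathfrak{s}):=\bigcup_{s\in\Gamma}P_s^*[X^*]$. Subskeleton: $(P_s)_{s\in\Gamma'}$ is a (projectional) subskeleton of $(P_s)_{s\in\Gamma}$ if $\Gamma'$ is a $\sigma$-closed subset of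 $\Gamma$ and $(P_s)_{s\in\Gamma'}$ is a projectional skeleton on $X$. Isomorphic: projectional skeletons $(Q_\lambda)_{\lambda\in\Lambda}$ and $(P_s)_{s\in\Gamma}$ on $X$ are isomorphic if there is an order-isomorphism $\phi:\Lambda\to\Gamma$ (a bijection with $\phi(s)\le\phi(t)$ iff $s\le t$) such that $Q_\lambda=P_{\phi(\lambda)}$ for every $\lambda\in\Lambda$. Rich family: a family $\mathcal{F}$ of closed separable subspaces of $X$ is rich if each closed separable subspace of $X$ is contained in an element of $\mathcal{F}$, and $\overline{\bigcup_n F_n}\in\mathcal{F}$ for every increasing sequence $(F_n)_{n\in\omega}$ in $\mathcal{F}$. A simple projectional skeleton on $X$ is a family of projections $(P_F)_{F\in\mathcal{F}}$ on $X$ indexed by a rich family $\mathcal{F}$ in $X$ ordered by inclusion such that $P_F[X]=F$ for every $F\in\mathcal{F}$, and $P_E=P_E\circ P_F=P_F\circ P_E$ whenever $E\subset F$ in $\mathcal{F}$. (Every simple projectional skeleton is a projectional skeleton.) *)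

(* Defs.v *)
From HB Require Import structures.
From mathcomp Require Import all_boot all_order all_algebra.
From mathcomp Require Import all_classical all_reals.
From mathcomp Require Import topology normedtype.
From mathcomp Require Import complex.

Import Order.TTheory GRing.Theory Num.Theory.
Import numFieldNormedType.Exports.

Local Open Scope classical_set_scope.
Local Open Scope ring_scope.

(* A Banach space is a complete normed space over the real or the complex
   numbers; [scalar_field R k] is one of these two fields. *)
Inductive scalars := RealScalars | ComplexScalars.

Definition scalar_field (R : realType) (k : scalars) : numFieldType :=
  match k with
  | RealScalars => R
  | ComplexScalars => R[i]%C
  end.

HB.instance Definition _ d (T : porderType d) (A : set T) :=
  SubChoice.on (set_type A).
HB.instance Definition _ d (T : porderType d) (A : set T) :=
  [SubChoice_isSubPOrder of set_type A by <: with d].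

Definition up_directed {d} (G : porderType d) :=
  forall a b : G, exists c : G, (a <= c)%O /\ (b <= c)%O.

Definition increasing_seq {d} {G : porderType d} (u : nat -> G) :=
  forall n, (u n <= u n.+1)%O.

Definition sigma_complete {d} (G : porderType d) :=
  forall u : nat -> G, increasing_seq u -> exists s, supremums (range u) s.

Definition sigma_closed {d} {G : porderType d} (H : set G) :=
  forall u : nat -> G, increasing_seq u -> (forall n, H (u n)) ->
  forall s, supremums (range u) s -> H s.

Definition order_isomorphism {d d'} {L : porderType d} {G : porderType d'}
    (phi : L -> G) :=
  bijective phi /\ forall s t : L, ((phi s <= phi t)%O <-> (s <= t)%O).

Section NormedSpaces.
Context {K : numFieldType}.

Definition bounded_linear {V W : normedModType K} (T : V -> W) :=
  linear T /\ exists M : K, forall x, `|T x| <= M * `|x|.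

Definition projection {X : normedModType K} (P : X -> X) :=
  bounded_linear P /\ forall x, P (P x) = P x.

Definition dual (X : normedModType K) : set (X -> K^o) :=
  [set f | bounded_linear f].

Definition adjoint {X : normedModType K} (P : X -> X) (f : X -> K^o) :
  X -> K^o :=
  f \o P.

Definition separable_set {X : normedModType K} (A : set X) :=
  exists C : set X, [/\ countable C, C `<=` A & A `<=` closure C].

Definition closed_separable_subspace {X : normedModType K} (Y : set X) :=
  [/\ submod_closed (mem Y), closed Y & separable_set Y].

End NormedSpaces.

Section Skeletons.
Context {K : numFieldType} {X : normedModType K}.

Definition projectional_skeleton {d} {G : porderType d} (P : G -> X -> X) :=
  [/\ up_directed G,
      sigma_complete G &
      forall s, projection (P s)] /\
  [/\ forall s, separable_set (range (P s)),
      forall s t, (s <= t)%O -> P s = P s \o P t /\ P s = P t \o P s,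
      forall (u : nat -> G) s, increasing_seq u -> supremums (range u) s ->
        range (P s) = closure (\bigcup_n range (P (u n))) &
      [set: X] = \bigcup_s range (P s)].

Definition induced_set {d} {G : porderType d} (P : G -> X -> X) :
  set (X -> K^o) :=
  \bigcup_s (adjoint (P s) @` dual X).

Definition subfamily {d} {G : porderType d} (P : G -> X -> X)
    (H : set G) : H -> X -> X :=
  fun s => P (val s).

Definition subskeleton {d} {G : porderType d} (P : G -> X -> X) (H : set G) :=
  sigma_closed H /\ projectional_skeleton (subfamily P H).

Definition isomorphic_skeletons {d d'} {L : porderType d} {G : porderType d'}
    (Q : L -> X -> X) (P : G -> X -> X) :=
  exists2 phi : L -> G, order_isomorphism phi & forall l, Q l = P (phi l).

Definition rich_family (F : set (set X)) :=
  [/\ forall Y, F Y -> closed_separable_subspace Y,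
      forall Y, closed_separable_subspace Y -> exists2 Z, F Z & Y `<=` Z &
      forall u : nat -> set X, (forall n, F (u n)) ->
        (forall n, u n `<=` u n.+1) -> F (closure (\bigcup_n u n))].

Definition simple_projectional_skeleton {F : set (set X)} (P : F -> X -> X) :=
  [/\ rich_family F,
      forall E, projection (P E),
      forall E, range (P E) = val E &
      forall E E' : F, val E `<=` val E' ->
        P E = P E \o P E' /\ P E = P E' \o P E].

End Skeletons.

(* Main.v *)
(** A tuple a = (a_n) with a_n in Gamma_n is called coherent when all the
    projections s_n(a_n) coincide and obey fixed norm bounds. Every tuple lies
    below a coherent one: since the induced sets agree, P_s* X* (which contains
    countably many functionals separating the points of the separable range of
    P_s, by Hahn-Banach) forces P_s = P_s o Q_t for some t in any other
    skeleton, and interleaving such choices gives suprema with equal ranges and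
    equal kernels. Coherent tuples are moreover closed under suprema of
    increasing sequences, so they form a single skeleton.

    To pick one coherent tuple psi(F) for each separable F, monotonically and
    compatibly with closures of increasing unions, cover X by open sets U_l that
    form countably many disjoint families at each scale (as in Stone's
    theorem). A separable F meets only countably many U_l, and "U_l meets F" is
    stable under closures of unions, so psi(F) can be taken to be the supremum
    of a monotone assignment over the finite sets of labels met by F. The rich
    family consists of those F that are the range of the projection of psi(F):
    on it F is recovered from psi(F)_n, so F |-> psi(F)_n is an order
    isomorphism onto its image for every n. *)

Require Import Defs.
From mathcomp Require Import all_boot all_order all_algebra.
From mathcomp Require Import all_classical all_reals.
From mathcomp Require Import topology normedtype.
From mathcomp Require Import wochoice complex finmap lra ring.

Set Implicit Arguments.
Unset Strict Implicit.
Unset Printing Implicit Defensive.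

Import Order.TTheory GRing.Theory Num.Theory.
Import numFieldNormedType.Exports.

Local Open Scope classical_set_scope.
Local Open Scope ring_scope.

(** * The Hahn-Banach theorem over the reals and the complex numbers *)

Section Sublinear.
Context {R : realType} {K : numFieldType} (io : {rmorphism R -> K})
  {V : lmodType K}.
Implicit Types (q : V -> R) (x y z : V).

(** Only real scalars, embedded by [io], enter the homogeneity, so that one argument serves real
    spaces and complex ones. *)
Definition sublinear q :=
  (forall x y, q (x + y) <= q x + q y) /\
  (forall (t : R) x, 0 <= t -> q (io t *: x) = t * q x).

Lemma sublinear0 q : sublinear q -> q 0 = 0.
Proof. by case=> _ /(_ 0 0 (lexx _)); rewrite scaler0 mul0r. Qed.

Lemma sublinear_suff q :
  q 0 = 0 -> (forall x y, q (x + y) <= q x + q y) ->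
  (forall (t : R) x, 0 < t -> q (io t *: x) <= t * q x) -> sublinear q.
Proof.
move=> q0 qD qZ; split=> // t x; rewrite le0r => /orP[/eqP ->|t0].
  by rewrite rmorph0 scale0r mul0r.
apply/eqP; rewrite eq_le qZ //=.
have ti : 0 < t^-1 by rewrite invr_gt0.
have := qZ _ (io t *: x) ti.
rewrite scalerA -rmorphM mulVf ?gt_eqF // rmorph1 scale1r.
by rewrite mulrC ler_pdivlMr // mulrC.
Qed.

(** Lowers [q] within the sublinear functionals, pushing the value at [- z] down to at most [- q z];
    a functional that cannot be lowered is therefore odd. *)
Definition descent q z x : R :=
  inf [set q (x + io t *: z) - t * q z | t in [set t : R | 0 <= t]].

Lemma sublinear_lb q x y : sublinear q -> - q (- x) <= q (x + y) - q y.
Proof.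
move=> [qD _]; have := qD (x + y) (- x).
by rewrite [x + y]addrC addrK; lra.
Qed.

Lemma descent_has_inf q z x : sublinear q ->
  has_inf [set q (x + io t *: z) - t * q z | t in [set t : R | 0 <= t]].
Proof.
move=> qs; split; first by exists (q (x + io 0 *: z) - 0 * q z); exists 0 => /=.
exists (- q (- x)) => _ [t /= t0 <-].
by case: (qs) => _ qZ; rewrite -qZ //; exact: sublinear_lb.
Qed.

Lemma descent_le q z x (t : R) : sublinear q -> 0 <= t ->
  descent q z x <= q (x + io t *: z) - t * q z.
Proof.
move=> qs t0; apply: ge_inf; last by exists t.
by have [] := descent_has_inf z x qs.
Qed.

Lemma le_descent q z x (c : R) : sublinear q ->
  (forall t, 0 <= t -> c <= q (x + io t *: z) - t * q z) ->
  c <= descent q z x.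
Proof.
move=> qs h; apply: lb_le_inf; first by have [] := descent_has_inf z x qs.
by move=> _ [t /= t0 <-]; exact: h.
Qed.

Lemma descent_le_id q z x : sublinear q -> descent q z x <= q x.
Proof.
move=> qs; have := descent_le z x qs (lexx 0).
by rewrite rmorph0 scale0r addr0 mul0r subr0.
Qed.

Lemma descent_opp q z : sublinear q -> descent q z (- z) <= - q z.
Proof.
move=> qs; have := descent_le z (- z) qs ler01.
by rewrite rmorph1 scale1r addNr mul1r sublinear0 // sub0r.
Qed.

Lemma descent_sublinear q z : sublinear q -> sublinear (descent q z).
Proof.
move=> qs; have [qD qZ] := qs; apply: sublinear_suff.
- apply/eqP; rewrite eq_le; apply/andP; split.
    by rewrite -(sublinear0 qs); exact: descent_le_id.
  apply: le_descent => // t t0; rewrite -qZ //.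
  by have := sublinear_lb 0 (io t *: z) qs; rewrite oppr0 sublinear0 // oppr0.
- move=> x y; rewrite -lerBlDr; apply: le_descent => // t t0.
  rewrite lerBlDr -lerBlDl; apply: le_descent => // s s0.
  rewrite lerBlDl; have ts : 0 <= t + s by exact: addr_ge0.
  apply: le_trans (descent_le z (x + y) qs ts) _.
  have := qD (x + io t *: z) (y + io s *: z).
  by rewrite addrACA -scalerDl -rmorphD; lra.
- move=> t x t0; rewrite mulrC -ler_pdivrMr //; apply: le_descent => // s s0.
  rewrite ler_pdivrMr // mulrBl ![_ * t]mulrC -qZ ?(ltW t0) // mulrA.
  rewrite scalerDr scalerA -rmorphM.
  by apply: descent_le => //; apply: mulr_ge0 => //; exact: ltW.
Qed.

(* A minimal sublinear functional below [p] equals all its descents, hence is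
   odd, hence linear. *)
Lemma sublinear_minimal p : sublinear p ->
  exists q, [/\ sublinear q, forall x, q x <= p x &
    forall q', sublinear q' -> (forall x, q' x <= q x) -> forall x, q' x = q x].
Proof.
move=> ps; pose T := {q : V -> R | sublinear q /\ forall x, q x <= p x}.
(* [below] reverses the pointwise order, so maximality for [Zorn] is pointwise minimality. *)
pose below (a b : T) := `[< forall x, sval b x <= sval a x >].
have [||| A Atot |[q [qs qp]] qmin] := @Zorn T below.
- by move=> a; apply/asboolP.
- move=> a b c /asboolP ab /asboolP bc; apply/asboolP => x.
  exact: le_trans (bc x) (ab x).
- move=> [a pa] [b pb] /asboolP /= ab /asboolP /= ba.
  by apply: eq_exist; apply/funext => x; apply/eqP; rewrite eq_le ba ab.
- have [[a0 Aa0]|A0] := pselect (A !=set0); last first.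
    exists (exist _ p (conj ps (fun x => lexx (p x)))) => a Aa.
    by exfalso; apply: A0; exists a.
  pose m x := inf [set sval a x | a in A].
  have hm x : has_inf [set sval a x | a in A].
    split; first by exists (sval a0 x), a0.
    exists (- p (- x)) => _ [[a [as_ ap]] _ <-] /=.
    have := sublinear_lb x 0 as_; rewrite addr0 sublinear0 // subr0.
    by apply: le_trans; rewrite lerN2; exact: ap.
  have m_le a x : A a -> m x <= sval a x.
    by move=> Aa; apply: ge_inf; [case: (hm x)|exists a].
  have le_m c x : (forall a, A a -> c <= sval a x) -> c <= m x.
    move=> h; apply: lb_le_inf; first by case: (hm x).
    by move=> _ [a Aa <-]; exact: h.
  have ms : sublinear m.
    apply: sublinear_suff.
    + apply/eqP; rewrite eq_le; apply/andP; split.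
        by rewrite -(sublinear0 (svalP a0).1) m_le.
      by apply: le_m => a _; rewrite (sublinear0 (svalP a).1).
    + move=> x y; rewrite -lerBlDr; apply: (le_m _ _) => a Aa.
      rewrite lerBlDr -lerBlDl; apply: le_m => b Ab; rewrite lerBlDl.
      have [/asboolP ab|/asboolP ba] := Atot _ _ Aa Ab.
        apply: le_trans (m_le b _ Ab) _.
        apply: le_trans ((svalP b).1.1 x y) _; rewrite lerD2r; exact: ab.
      apply: le_trans (m_le a _ Aa) _.
      apply: le_trans ((svalP a).1.1 x y) _; rewrite lerD2l; exact: ba.
    + move=> t x t0; rewrite mulrC -ler_pdivrMr //; apply: (le_m _ _) => a Aa.
      rewrite ler_pdivrMr // mulrC -(svalP a).1.2 ?(ltW t0) //.
      exact: m_le.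
  have mp x : m x <= p x by exact: le_trans (m_le a0 x Aa0) ((svalP a0).2 x).
  exists (exist _ m (conj ms mp)) => a Aa; apply/asboolP => x /=; exact: m_le.
exists q; split=> // q' q's q'q x.
have q'p y : q' y <= p y by exact: le_trans (q'q y) (qp y).
have := qmin (exist _ q' (conj q's q'p)).
rewrite /below /= => /(_ (asboolT q'q)) /(congr1 sval) /= ->.
by [].
Qed.

(** Minimizing below [descent p x0] rather than [p] secures the value at [x0]: the bound [- p x0] at
    [- x0] turns, by oddness, into [p x0 <= g x0]. *)
Lemma Hahn_Banach p x0 : sublinear p ->
  exists g : V -> R, [/\ forall x y, g (x + y) = g x + g y,
    forall t x, g (io t *: x) = t * g x, forall x, g x <= p x & g x0 = p x0].
Proof.
move=> ps; have [q [qs qp qmin]] := sublinear_minimal (descent_sublinear x0 ps).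
have qN x : q (- x) = - q x.
  apply/eqP; rewrite eq_le; apply/andP; split.
    rewrite -(qmin _ (descent_sublinear x qs)); first exact: descent_opp.
    by move=> y; exact: descent_le_id.
  by have := sublinear_lb x 0 qs; rewrite addr0 sublinear0 // subr0; lra.
have qp' x : q x <= p x by exact: le_trans (qp x) (descent_le_id x0 x ps).
have [qD qZ] := qs; exists q; split=> //.
- move=> x y; apply/eqP; rewrite eq_le qD /=.
  by have := qD (- x) (- y); rewrite -opprD !qN; lra.
- move=> t x; have [|t0] := leP 0 t; first exact: qZ.
  rewrite -[t in LHS]opprK rmorphN scaleNr qN qZ ?mulNr ?opprK //.
  by rewrite oppr_ge0 ltW.
- apply/eqP; rewrite eq_le qp' /=.
  have := le_trans (qp (- x0)) (descent_opp x0 ps).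
  by rewrite qN lerN2.
Qed.

End Sublinear.

Definition norming_dual {K : numFieldType} (X : normedModType K) :=
  forall x : X, exists2 f, dual X f & `|f x| = `|x| /\ forall y, `|f y| <= `|y|.

Lemma norming_dual_real (R : realType) (X : normedModType R) : norming_dual X.
Proof.
move=> x.
have ps : sublinear (idfun : {rmorphism R -> R}) (fun y : X => `|y|).
  by split=> [y z|t y t0]; rewrite ?ler_normD // normrZ ger0_norm.
have [g [gD gZ gp gx]] := Hahn_Banach x ps.
have g_le y : `|g y| <= `|y|.
  rewrite ler_norml gp andbT lerNl.
  by rewrite -mulN1r -(gZ (-1)) /= scaleN1r -(normrN y); exact: gp.
exists g; last by split=> //; rewrite gx normr_id.
split; first by move=> a y z; rewrite gD (gZ a).
by exists 1 => y; rewrite mul1r; exact: g_le.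
Qed.

Lemma complex_normE (R : realType) (X : normedModType R[i]%C) (x : X) :
  real_complex R (complex.Re `|x|) = `|x|.
Proof. by rewrite RRe_real // normr_real. Qed.

(** The real functional [g] from Hahn-Banach is the real part of the complex-linear
    [f y = g y - i g (i y)]. *)
Lemma norming_dual_complex (R : realType) (X : normedModType R[i]%C) :
  norming_dual X.
Proof.
move=> x.
have lecC (a b : R) : (real_complex R a <= real_complex R b) = (a <= b).
  by rewrite lecR.
have ps : sublinear (real_complex R) (fun y : X => complex.Re `|y|).
  split=> [y z|t y t0].
    by rewrite -lecC rmorphD /= !complex_normE ler_normD.
  apply: complexI; rewrite complex_normE rmorphM /= complex_normE normrZ.
  by rewrite ger0_norm // ler0c.
have [g [gD gZ gp gx]] := Hahn_Banach x ps.
pose f (y : X) : (R[i]%C)^o := Complex (g y) (- g ('i%C *: y)).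
have gN y : g (- y) = - g y.
  by rewrite -mulN1r -(gZ (-1)) rmorphN1 scaleN1r.
have fD y z : f (y + z) = f y + f z.
  by rewrite /f scalerDr !gD opprD.
have gC a y : g (a *: y) = complex.Re a * g y + complex.Im a * g ('i%C *: y).
  by rewrite [a in LHS]complexE scalerDl gD gZ ['i%C * _]mulrC -scalerA gZ.
have fZ a y : f (a *: y) = a * f y.
  rewrite /f scalerA (gC a) (gC ('i%C * a)); case: a => a b /=.
  apply/eqP; rewrite eq_complex /=; apply/andP; split; apply/eqP; ring.
have f_le y : `|f y| <= `|y|.
  have [->|fy0] := eqVneq (f y) 0; first by rewrite normr0.
  have nf : 0 < `|f y| by rewrite normr_gt0.
  (* Multiplying [y] by the conjugate of [f y] makes the value of [f] equal to its real part, so the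
     bound on [g] applies; a factor [|f y|] then cancels. *)
  have fw : f ((f y)^*%C *: y) = `|f y| ^+ 2 by rewrite fZ sqr_normc mulrC.
  have := gp ((f y)^*%C *: y).
  have -> : g ((f y)^*%C *: y) = complex.Re (f ((f y)^*%C *: y)) by [].
  rewrite fw -lecC complex_normE RRe_real ?rpredX ?normr_real //.
  by rewrite normrZ normcJ expr2 ler_pM2l.
exists f.
  split; first by move=> a y z; rewrite fD fZ.
  by exists 1 => y; rewrite mul1r; exact: f_le.
split=> //; apply/eqP; rewrite eq_le f_le /=.
rewrite -(complex_normE x) -gx; apply: le_trans (normc_ge_Re (f x)).
by rewrite lecC ler_norm.
Qed.

Lemma norming_dual_scalar (R : realType) (k : scalars)
  (X : normedModType (scalar_field R k)) : norming_dual X.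
Proof.
by case: k X => X; [exact: norming_dual_real|exact: norming_dual_complex].
Qed.

(** The order of [K] is only partial in the complex case; this property supplies natural norm bounds
    and arbitrarily small radii [n.+1%:R^-1]. *)
Definition archimedean_norm (K : numFieldType) :=
  forall x : K, exists n : nat, `|x| <= n%:R.

Lemma archimedean_scalar (R : realType) (k : scalars) :
  archimedean_norm (scalar_field R k).
Proof.
have arch (r : R) : exists n : nat, r <= n%:R.
  exists (Num.bound `|r|); apply: le_trans (ler_norm r) _.
  exact/ltW/archi_boundP.
case: k => x; first exact: (arch `|x|).
have [n xn] := arch (complex.Re `|x|); exists n.
by rewrite -(RRe_real (normr_real x)) -(rmorph_nat (real_complex R)) lecR.
Qed.

(** * Monotone sigma-continuous maps into sigma-complete orders *)

Lemma increasing_seq_sub {L : Type} (A : nat -> set L) i j :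
  (forall i, A i `<=` A i.+1) -> (i <= j)%N -> A i `<=` A j.
Proof.
move=> AS /subnK <-; elim: (j - i)%N => [//|n IH].
by rewrite addSn => x /IH /AS.
Qed.

Lemma seq_sub_bigcup {L : eqType} (A : nat -> set L) (s : seq L) :
  (forall i, A i `<=` A i.+1) -> (forall x, x \in s -> exists i, A i x) ->
  exists n, forall x, x \in s -> A n x.
Proof.
move=> AS; elim: s => [|x s IH] sA; first by exists 0%N.
have [n sn] : exists n, forall x, x \in s -> A n x.
  by apply: IH => y ys; apply: sA; rewrite inE ys orbT.
have [m xm] := sA x (mem_head _ _).
exists (maxn n m) => y; rewrite inE => /predU1P[->|/sn].
  exact: (increasing_seq_sub AS (leq_maxr n m)).
exact: (increasing_seq_sub AS (leq_maxl n m)).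
Qed.

Section SigmaComplete.
Context {T : Type} (le : T -> T -> Prop) (good : set T) {L : choiceType}.
Hypothesis le_trans : forall b a c, le a b -> le b c -> le a c.

(** The competing bounds [t] range over all of [T], not only over [good]: suprema of coherent tuples
    will have to be suprema in each order [G n]. *)
Definition lub (S : set T) s :=
  (forall a, S a -> le a s) /\ (forall t, (forall a, S a -> le a t) -> le s t).

Hypothesis good_ub : forall a b, exists c, [/\ good c, le a c & le b c].
Hypothesis good_lub : forall u : nat -> T, (forall i, good (u i)) ->
  (forall i, le (u i) (u i.+1)) -> exists2 s, good s & lub (range u) s.

Lemma seq_good_ub (I : eqType) (f : I -> T) (a0 : T) (s : seq I) :
  exists2 c, good c & forall i, i \in s -> le (f i) c.
Proof.
elim: s => [|i s [c gc sc]].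
  by have [c [gc _ _]] := good_ub a0 a0; exists c.
have [b [gb fb cb]] := good_ub (f i) c; exists b => // j.
by rewrite inE => /predU1P[->//|/sc jc]; exact: le_trans jc cb.
Qed.

(* Iterating "an upper bound over all subsets of A" and taking the supremum of
   the iterates forces monotonicity. *)
Lemma fset_monotone_map (g : L -> T) (a0 : T) :
  exists phi : {fset L} -> T, [/\ forall A, good (phi A),
    forall A B, (A `<=` B)%fset -> le (phi A) (phi B) &
    forall l, le (g l) (phi [fset l]%fset)].
Proof.
have ubg (A : {fset L}) : exists c, good c /\ forall l, l \in A -> le (g l) c.
  by have [c gc cA] := seq_good_ub g a0 (enum_fset A); exists c.
have [f0 f0P] := choice ubg.
have ubf (fA : ({fset L} -> T) * {fset L}) : exists c, good c /\
    forall B, (B `<=` fA.2)%fset -> le (fA.1 B) c.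
  have [c gc cA] := seq_good_ub fA.1 a0 (enum_fset (fpowerset fA.2)).
  exists c; split=> // B BA; apply: cA.
  by rewrite -[_ \in _]/(_ \in fpowerset _) fpowersetE.
have [nx nxP] := choice ubf.
pose fs := fix fs (n : nat) : {fset L} -> T :=
  if n is m.+1 then fun A => nx (fs m, A) else f0.
have fs_good n A : good (fs n A).
  by case: n => [|n]; [exact: (f0P A).1|exact: (nxP (_, A)).1].
have fs_le n A B : (A `<=` B)%fset -> le (fs n A) (fs n.+1 B).
  by move=> AB; exact: (nxP (_, B)).2.
have fs_lub A : exists s, good s /\ lub (range (fs ^~ A)) s.
  have [] := @good_lub (fs ^~ A) => [n|n|s gs sA]; [exact: fs_good|exact: fs_le|].
  by exists s.
have [phi phiP] := choice fs_lub.
exists phi; split=> [A|A B AB|l]; first exact: (phiP A).1.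
- apply: (phiP A).2.2 => _ [n _ <-]; apply: le_trans (fs_le n _ _ AB) _.
  by apply: (phiP B).2.1; exists n.+1.
- apply: (@le_trans (f0 [fset l]%fset)); last by apply: (phiP _).2.1; exists 0%N.
  by apply: (f0P _).2; rewrite inE.
Qed.

(** [Phi A] is the supremum of [phi] over the finite subsets of [A], reached along the prefixes of
    an enumeration. Unions are respected because a finite subset of an increasing union lies in one
    member. *)
Lemma sigma_continuous_map (g : L -> T) (a0 : T) :
  exists Phi : set L -> T, [/\
    forall A, countable A -> A !=set0 -> good (Phi A),
    forall A B, countable A -> countable B -> A !=set0 -> A `<=` B ->
      le (Phi A) (Phi B),
    forall A l, countable A -> A l -> le (g l) (Phi A) &
    forall A : nat -> set L, (forall i, countable (A i)) -> A 0%N !=set0 ->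
      (forall i, A i `<=` A i.+1) ->
      lub (range (fun i => Phi (A i))) (Phi (\bigcup_i A i))].
Proof.
have [phi [phi_good phi_le phi_g]] := fset_monotone_map g a0.
have lubA (A : set L) : exists s, countable A -> A !=set0 ->
    good s /\ lub (phi @` [set B : {fset L} | forall x, x \in B -> A x]) s.
  have [[cA [l0 Al0]]|nA] := pselect (countable A /\ A !=set0); last first.
    by exists a0 => cA A0; exfalso; apply: nA.
  have [a Aa] : exists a : nat -> L, A = range a.
    have /pfcard_geP[A0|[a]] := cA; first by move: Al0; rewrite A0.
    exists a; rewrite eqEsubset; split; first exact: 'surj_a.
    by move=> _ [n _ <-]; exact: 'funS_a.
  pose pre n := [fset x in map a (iota 0 n.+1)]%fset.
  have preP n x : reflect (exists2 k, (k <= n)%N & x = a k) (x \in pre n).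
    have -> : (x \in pre n) = (x \in map a (iota 0 n.+1)) by rewrite in_fset.
    apply: (iffP mapP) => -[k].
      by rewrite mem_iota => kn ->; exists k.
    by move=> kn ->; exists k => //; rewrite mem_iota.
  have preS i : (pre i `<=` pre i.+1)%fset.
    by apply/fsubsetP => x /preP[k ki ->]; apply/preP; exists k => //; exact: leqW.
  have [] := @good_lub (phi \o pre) => [i|i|s gs [s_ub s_lub]].
  - exact: phi_good.
  - exact/phi_le/preS.
  exists s => _ _; split=> //; split=> [_ [B BA <-]|t tub].
    have [n Bn] : exists n, forall x, x \in B -> x \in pre n.
      apply: (@seq_sub_bigcup _ (fun n x => x \in pre n) (enum_fset B)).
        by move=> i x /=; exact: (fsubsetP (preS i)).
      move=> x /BA; rewrite Aa => -[k _ <-]; exists k.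
      by apply/preP; exists k.
    apply: le_trans (s_ub _ _); last by exists n.
    exact/phi_le/fsubsetP.
  apply: s_lub => _ [n _ <-]; apply: tub; exists (pre n) => //.
  by move=> x /preP[k _ ->]; rewrite Aa; exists k.
have [Phi PhiP] := choice lubA.
exists Phi; split=> [A cA A0|A B cA cB A0 AB|A l cA Al|A cA A0 AS].
- exact: (PhiP A cA A0).1.
- have B0 : B !=set0 by case: A0 => x /AB; exists x.
  apply: (PhiP A cA A0).2.2 => _ [C CA <-]; apply: (PhiP B cB B0).2.1.
  by exists C => // x /CA /AB.
- have A0 : A !=set0 by exists l.
  apply: le_trans (phi_g l) _; apply: (PhiP A cA A0).2.1.
  by exists [fset l]%fset => // x /=; rewrite inE => /eqP ->.
have A0i i : A i !=set0.
  by case: A0 => x /(increasing_seq_sub AS (leq0n i)); exists x.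
have cU : countable (\bigcup_i A i) by apply: bigcup_countable.
have U0 : \bigcup_i A i !=set0 by case: A0 => x; exists x, 0%N.
have [_ [U_ub U_lub]] := PhiP _ cU U0.
split=> [_ [i _ <-]|t tub].
  apply: (PhiP _ (cA i) (A0i i)).2.2 => _ [B BA <-]; apply: U_ub.
  by exists B => // x /BA; exists i.
apply: U_lub => _ [B BA <-].
have [n Bn] : exists n, forall x, x \in B -> A n x.
  apply: (@seq_sub_bigcup _ A (enum_fset B)) => // x /BA [i _ Aix].
  by exists i.
apply: (@le_trans (Phi (A n))); last by apply: tub; exists n.
by apply: (PhiP _ (cA n) (A0i n)).2.1; exists B.
Qed.

End SigmaComplete.

(** * Norms, closures and sigma-disjoint open covers *)

Section NormedClosure.
Context {K : numFieldType} {X : normedModType K}.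

Lemma closure_normP (A : set X) (y : X) :
  closure A y <-> forall e : K, 0 < e -> exists2 z, A z & `|y - z| < e.
Proof.
split=> [Ay e e0|h B /nbhs_ballP[e /= e0 eB]].
  have [z [Az yz]] := Ay _ (nbhsx_ballx y e e0).
  by exists z => //; move: yz; rewrite -ball_normE.
have [z Az yz] := h e e0; exists z; split=> //.
by apply: eB; rewrite -ball_normE.
Qed.

Lemma closed_normP (A : set X) (y : X) : closed A ->
  (forall e : K, 0 < e -> exists2 z, A z & `|y - z| < e) -> A y.
Proof. by move=> cA /closure_normP /cA. Qed.

Lemma le_of_small (a b c : K) : a \is Num.real -> b \is Num.real -> 0 <= c ->
  (forall e, 0 < e -> a <= b + c * e) -> a <= b.
Proof.
move=> ar br c0 h; have [//|ba] := real_leP ar br.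
have c1 : 0 < c + 1 by rewrite ltr_wpDl.
have d0 : 0 < (a - b) / (c + 1) by rewrite divr_gt0 // subr_gt0.
have := h _ d0; rewrite mulrA -lerBlDl ler_pdivlMr // mulrDr mulr1.
by rewrite [c * _]mulrC gerDl subr_le0 (lt_geF ba).
Qed.

End NormedClosure.

Section SigmaDisjointCover.
Context {K : numFieldType} (arch : archimedean_norm K) {X : normedModType K}.

Lemma exists_invS_lt (e : K) : 0 < e -> exists n : nat, n.+1%:R^-1 < e.
Proof.
move=> e0; have [n en] := arch e^-1; exists n.
have ei0 : 0 < e^-1 by rewrite invr_gt0.
rewrite invf_plt ?posrE ?ltr0Sn //.
by apply: le_lt_trans (_ : n%:R < _); rewrite ?ltr_nat // -(gtr0_norm ei0).
Qed.

(* M. E. Rudin's construction from Stone's theorem: for fixed indices the sets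
   are pairwise disjoint, and the third component of the label is a centre. *)
Lemma sigma_disjoint_cover : exists U : nat * nat * X -> set X,
  [/\ forall l, open (U l), forall p, countable [set l | U l p] &
    forall p (e : K), 0 < e -> exists2 l, U l p & `|p - l.2| < e].
Proof.
have [W Wwo] := well_ordering_principle X.
have Wanti x y : W x y -> W y x -> x = y.
  move=> xy yx; have WT : wo_chain W (mem X) by move=> A _; exact: Wwo.
  by apply: (wo_chain_antisymmetric WT) => //; rewrite xy.
pose r (n : nat) : K := n.+1%:R^-1.
have r0 n : 0 < r n by rewrite invr_gt0 ltr0Sn.
(* Points whose least centre within [r k] is [x], with a margin [3 * r n] that will keep the
   [r n]-neighbourhoods for distinct centres disjoint. *)
pose core k n x : set X := [set c | [/\ `|c - x| < r k,
  forall z, `|c - z| < r k -> W x z &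
  forall q, `|c - q| < 3 * r n -> `|q - x| < r k]].
pose U (l : nat * nat * X) : set X :=
  [set p | exists2 c, core l.1.1 l.1.2 l.2 c & `|c - p| < r l.1.2].
have U_uniq k n x y p : U (k, n, x) p -> U (k, n, y) p -> x = y.
  move=> [c /= [cx cxm cxb] cp] [c' /= [c'y c'ym c'yb] c'p].
  (* A common point [p] brings the two core points within [2 * r n], so each centre is [r k]-close
     to both of them, and minimality applies both ways. *)
  have cc' : `|c - c'| < 3 * r n.
    apply: le_lt_trans (ler_distD p c c') _.
    rewrite (_ : 3 * r n = r n + (r n + r n)); last by ring.
    apply: ltrD => //; rewrite distrC (lt_le_trans c'p) // lerDl ltW //.
  apply: Wanti; first by apply: cxm; apply: c'yb; rewrite distrC.
  by apply: c'ym; exact: cxb.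
exists U; split.
- move=> l; rewrite openE => p [c cl cp]; apply/nbhs_ballP.
  exists (r l.1.2 - `|c - p|); first by rewrite /= subr_gt0.
  move=> q; rewrite -ball_normE /= => pq; exists c => //.
  by apply: le_lt_trans (ler_distD p c q) _; rewrite addrC -ltrBrDr.
- move=> p; pose g (kn : nat * nat) := xget 0 [set x | U (kn, x) p].
  apply: (@sub_countable _ _ _ ((fun kn => (kn, g kn)) @` setT)); last first.
    exact: sub_countable (card_image_le _ _) (countableP _).
  apply: subset_card_le => -[[k n] x] /= Ux; exists (k, n) => //.
  congr (_, _); apply: (U_uniq k n _ _ p) => //.
  by apply: (xgetPex 0 (P := [set x | U (k, n, x) p])); exists x.
- move=> p e /exists_invS_lt[k ke].
  have [|x [[/asboolP px xm] _]] := Wwo [pred x | `[< `|p - x| < r k >]].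
    by exists p; apply/asboolP; rewrite subrr normr0.
  (* This bound makes [3 * r n] smaller than [r k - |p - x|], so that [p] itself lies in the core of
     [x]. *)
  have d0 : 0 < (r k - `|p - x|) / 3 by rewrite divr_gt0 ?subr_gt0 ?ltr0Sn.
  have [n nd] := exists_invS_lt d0.
  exists (k, n, x); last exact: lt_trans px ke.
  exists p; last by rewrite subrr normr0.
  split=> // [z pz|q pq]; first by apply: xm; apply/asboolP.
  apply: le_lt_trans (ler_distD p q x) _; rewrite -ltrBrDr distrC.
  apply: (lt_trans pq); rewrite mulrC -ltr_pdivlMr ?ltr0Sn //.
Qed.

End SigmaDisjointCover.

(** * Projectional skeletons *)

Section Skeleton.
Context {K : numFieldType} {X : normedModType K}.

Lemma linear_funB {V W : lmodType K} (T : V -> W) : linear T ->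
  forall x y, T (x - y) = T x - T y.
Proof.
by move=> Tl x y; rewrite addrC -scaleN1r Tl scaleN1r addrC.
Qed.

Lemma linear_fun0 {V W : lmodType K} (T : V -> W) : linear T -> T 0 = 0.
Proof. by move=> Tl; rewrite -(subrr 0) linear_funB // subrr. Qed.

Definition bounded_by (N : nat) (T : X -> X) :=
  forall x, `|T x| <= N%:R * `|x|.

Lemma bounded_linear_bounded_by (T : X -> X) : archimedean_norm K ->
  bounded_linear T -> exists N, bounded_by N T.
Proof.
move=> arch [_ [M TM]]; have [N MN] := arch M; exists N => x.
have M0 : 0 <= M * `|x| by apply: le_trans (TM x).
apply: le_trans (TM x) _; rewrite -(ger0_norm M0) normrM normr_id.
exact: ler_wpM2r.
Qed.

Context {d : Order.disp_t} {G : porderType d} {P : G -> X -> X}.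
Hypothesis sk : projectional_skeleton P.

Lemma skeleton_linear s : linear (P s).
Proof. by case: sk => -[_ _ /(_ s) [[]]]. Qed.

Lemma skeleton_idem s x : P s (P s x) = P s x.
Proof. by case: sk => -[_ _ /(_ s) [_]]. Qed.

Lemma skeleton_compl s t x : (s <= t)%O -> P s (P t x) = P s x.
Proof.
by case: sk => _ [_ /(_ s t) h _ _] /h [/(congr1 (@^~ x)) /= <-].
Qed.

Lemma skeleton_compr s t x : (s <= t)%O -> P t (P s x) = P s x.
Proof.
by case: sk => _ [_ /(_ s t) h _ _] /h [_ /(congr1 (@^~ x)) /= <-].
Qed.

Lemma skeleton_range s x : range (P s) x <-> P s x = x.
Proof. by split=> [[y _ <-]|<-]; [exact: skeleton_idem|exists x]. Qed.

Lemma skeleton_range_le s t : (s <= t)%O -> range (P s) `<=` range (P t).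
Proof. by move=> st _ [x _ <-]; exists (P s x) => //; exact: skeleton_compr. Qed.

Lemma skeleton_sup (u : nat -> G) s : increasing_seq u ->
  supremums (range u) s -> range (P s) = closure (\bigcup_n range (P (u n))).
Proof. by case: sk => _ [_ _ + _]; apply. Qed.

Lemma skeleton_cover x : exists s, range (P s) x.
Proof.
have [_ [_ _ _ cover]] := sk.
have [s _ sx] : (\bigcup_s range (P s)) x by rewrite -cover.
by exists s.
Qed.

Lemma skeleton_closed s : closed (range (P s)).
Proof.
have -> : range (P s) = closure (\bigcup_(n : nat) range (P s)).
  apply: (@skeleton_sup (fun=> s)) => [n|]; first exact: lexx.
  split=> [_ [_ _ <-]|t]; first exact: lexx.
  by apply; exists 0%N.
exact: closed_closure.
Qed.

Lemma skeleton_submod s : submod_closed (mem (range (P s))).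
Proof.
split=> [|a x y]; rewrite !in_setE.
  by exists 0 => //; rewrite linear_fun0 //; exact: skeleton_linear.
move=> [x' _ <-] [y' _ <-]; exists (a *: x' + y') => //.
by rewrite skeleton_linear.
Qed.

Lemma skeleton_css s : closed_separable_subspace (range (P s)).
Proof.
split; [exact: skeleton_submod|exact: skeleton_closed|].
by case: sk => _ [].
Qed.

Lemma skeleton_ub (u : nat -> G) : exists t, forall n, (u n <= t)%O.
Proof.
case: sk => -[dir sc _] _.
have /choice[ub ubP] : forall ab : G * G, exists c, (ab.1 <= c)%O /\ (ab.2 <= c)%O.
  by move=> [a b]; exact: dir.
pose v := fix v n := if n is m.+1 then ub (v m, u m.+1) else u 0%N.
have vS : increasing_seq v by move=> n; exact: (ubP (v n, u n.+1)).1.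
have uv n : (u n <= v n)%O by case: n => [|n]; [exact: lexx|exact: (ubP (_, _)).2].
have [t [tub _]] := sc v vS; exists t => n.
by apply: le_trans (uv n) _; apply: tub; exists n.
Qed.

(** Otherwise each [N] has an index [u N] with no [N]-bounded projection above it; yet the
    projection at a common upper bound of all [u N] is bounded by some natural number. *)
Lemma skeleton_bounded_cofinal : archimedean_norm K ->
  exists N, forall s, exists2 t, (s <= t)%O & bounded_by N (P t).
Proof.
move=> arch; apply: contrapT => nN.
have /choice[u uP] : forall N, exists s,
    forall t, (s <= t)%O -> ~ bounded_by N (P t).
  move=> N; apply: contrapT => ns; apply: nN; exists N => s.
  apply: contrapT => nt; apply: ns; exists s => t st bt.
  by apply: nt; exists t.
have [t ut] := skeleton_ub u.
have [|N bN] := @bounded_linear_bounded_by (P t) arch.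
  by case: sk => -[_ _ /(_ t) []].
exact: uP N t (ut N) bN.
Qed.

Section BoundedSup.
Context {N : nat} {u : nat -> G} {s : G}.
Hypothesis u_incr : increasing_seq u.
Hypothesis u_sup : supremums (range u) s.
Hypothesis u_bound : forall i, bounded_by N (P (u i)).

(** Some [z] in the range of a [P (u i)] is close to [P s x]. Since [z = P (u i) z] and
    [P (u i) x = P (u i) (P s x)], the error is at most [|P s x - z| + N |z - P s x|]. *)
Lemma skeleton_sup_approx x (e : K) : 0 < e ->
  exists i, `|P s x - P (u i) x| <= (1 + N%:R) * e.
Proof.
move=> e0; have : range (P s) (P s x) by exists x.
rewrite (skeleton_sup u_incr u_sup) => /closure_normP /(_ e e0)[z [i _ zi] yz].
exists i; rewrite -(@skeleton_compl (u i) s); last by apply: u_sup.1; exists i.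
apply: le_trans (ler_distD z _ _) _; rewrite mulrDl mul1r lerD // ?(ltW yz) //.
move/skeleton_range: zi => {1}<-; rewrite -linear_funB; last exact: skeleton_linear.
apply: le_trans (u_bound _ _) _.
by rewrite ler_wpM2l ?ler0n // distrC ltW.
Qed.

Lemma skeleton_sup_bounded : bounded_by N (P s).
Proof.
move=> x; apply: (@le_of_small _ _ _ (1 + N%:R)).
- exact: normr_real.
- by rewrite realM ?normr_real ?realn.
- by rewrite addr_ge0 ?ler0n.
move=> e /(skeleton_sup_approx x)[i xi].
rewrite -lerBlDl; apply: le_trans xi; apply: le_trans (lerB_dist _ _).
by rewrite lerD2l lerN2; exact: u_bound.
Qed.

Lemma skeleton_sup_eq0 y : range (P s) y -> (forall i, P (u i) y = 0) -> y = 0.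
Proof.
move=> /skeleton_range ys yi; apply/normr0_eq0/eqP; rewrite eq_le normr_ge0 andbT.
apply: (@le_of_small _ _ _ (1 + N%:R)); rewrite ?normr_real ?real0 //.
  by rewrite addr_ge0 ?ler0n.
move=> e e0; have [j] := skeleton_sup_approx y e0.
by rewrite ys yi subr0 add0r.
Qed.

(** The difference [P s x - Q t x] lies in the common range and is killed by all [P (u i)], which
    approximate the identity there. *)
Lemma skeleton_sup_eq d' (G' : porderType d') (Q : G' -> X -> X) t :
  projectional_skeleton Q -> range (P s) = range (Q t) ->
  (forall i x, P (u i) (Q t x) = P (u i) x) -> P s = Q t.
Proof.
move=> skQ PQ uQ; apply/funext => x; apply/subr0_eq.
have [w _ wx] : range (P s) (Q t x) by rewrite PQ; exists x.
have lP r := @linear_funB _ _ _ (skeleton_linear r).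
apply: skeleton_sup_eq0; first by exists (x - w) => //; rewrite lP wx.
move=> i; rewrite lP uQ skeleton_compl ?subrr //.
by apply: u_sup.1; exists i.
Qed.

End BoundedSup.
End Skeleton.

(** Functionals [f n] norming a dense sequence of the range of [P s] separate its points. Each
    [f n \o P s] factors through some [Q (t n)], so above all the [t n] no [f n] distinguishes
    [P s (Q t' x)] from [P s x]. Bounding countably many further indices captures the dense
    sequence, hence the range. *)
Lemma skeleton_absorb {K : numFieldType} {X : normedModType K}
    d (G : porderType d) (P : G -> X -> X)
    d' (G' : porderType d') (Q : G' -> X -> X) (s : G) :
  norming_dual X -> projectional_skeleton P -> projectional_skeleton Q ->
  induced_set P `<=` induced_set Q ->
  exists t, forall t', (t <= t')%O ->
    (forall x, P s (Q t' x) = P s x) /\ range (P s) `<=` range (Q t').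
Proof.
move=> nd skP skQ PQ.
have [C [cC Cs sC]] : separable_set (range (P s)) by case: skP => _ [].
have [c Cc] : exists c : nat -> X, C = range c.
  have /pfcard_geP[C0|[c]] := cC.
    have : range (P s) 0.
      by exists 0 => //; rewrite linear_fun0 //; exact: (skeleton_linear skP).
    by move=> /sC; rewrite C0 closure0.
  exists c; rewrite eqEsubset; split; first exact: 'surj_c.
  by move=> _ [n _ <-]; exact: 'funS_c.
have /choice[f fP] : forall n, exists f, dual X f /\
    (`|f (c n)| = `|c n| /\ forall y, `|f y| <= `|y|).
  by move=> n; have [f df fn] := nd (c n); exists f.
have /choice[t tP] : forall n, exists t, exists g : X -> K^o, f n \o P s = g \o Q t.
  move=> n; have [t _ [g _ gE]] : induced_set Q (f n \o P s).
    by apply: PQ; exists s => //; exists (f n) => //; exact: (fP n).1.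
  by exists t, g; rewrite -gE.
have /choice[r rP] : forall n, exists r, range (Q r) (c n).
  by move=> n; have [r rn] := skeleton_cover skQ (c n); exists r.
have [t1 t1P] := skeleton_ub skQ t; have [t2 t2P] := skeleton_ub skQ r.
have [t0 [t10 t20]] : exists t0, (t1 <= t0)%O /\ (t2 <= t0)%O.
  by case: skQ => -[+ _ _] _; apply.
exists t0 => t' tt'; split; last first.
  apply: subset_trans sC _.
  apply: (subset_trans _ (@skeleton_closed _ _ _ _ _ skQ t')).
  apply: closureS; rewrite Cc => _ [n _ <-].
  apply: (skeleton_range_le skQ _ (rP n)).
  exact: le_trans (le_trans (t2P n) t20) tt'.
move=> x; apply/subr0_eq.
have lP := linear_funB (skeleton_linear skP s); rewrite -lP.
set y := P s _.
have fy n : f n y = 0.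
  have [g gE] := tP n; rewrite /y lP linear_funB; last exact: (fP n).1.1.
  have fg z : f n (P s z) = g (Q (t n) z) by have := congr1 (@^~ z) gE.
  rewrite !fg (skeleton_compl skQ) ?subrr //.
  exact: le_trans (le_trans (t1P n) t10) tt'.
apply/normr0_eq0/eqP; rewrite eq_le normr_ge0 andbT.
(* For [c n] within [e] of [y], [f n y = 0] gives [|c n| = |f n (c n - y)| <= e], hence
   [|y| <= 2 * e]. *)
apply: (@le_of_small _ _ _ 2); rewrite ?normr_real ?real0 // => e e0.
have /sC /closure_normP /(_ e e0)[z] : range (P s) y by exists (Q t' x - x).
rewrite Cc => -[n _ <-] yc; rewrite add0r mulr2n mulrDl mul1r.
rewrite -[y](subrK (c n)); apply: le_trans (ler_normD _ _) _.
apply: lerD; first exact: ltW.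
have [[fl _] [<- fn]] := fP n.
have -> : f n (c n) = f n (c n - y) by rewrite linear_funB // fy subr0.
by apply: le_trans (fn _) _; rewrite distrC ltW.
Qed.

(** Sigma-closedness places suprema taken in [G] inside [H], and uniqueness identifies them with the
    suprema taken in [H], so the axioms on suprema pass to [H]. *)
Lemma subskeleton_suff {K : numFieldType} {X : normedModType K}
    d (G : porderType d) (P : G -> X -> X) (H : set G) :
  projectional_skeleton P -> sigma_closed H ->
  (forall a b, H a -> H b -> exists c, [/\ H c, (a <= c)%O & (b <= c)%O]) ->
  (forall x, exists2 a, H a & range (P a) x) -> subskeleton P H.
Proof.
move=> sk sH dirH covH; split=> //.
have [[dir sc pr] _] := sk.
have HP (a : H) : H (val a) by exact: set_valP.
have val_incr (u : nat -> H) : increasing_seq u ->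
    increasing_seq (fun n => val (u n)).
  by move=> uS n; have := uS n; rewrite leEsub.
have sup_H (u : nat -> H) t : supremums (range (fun n => val (u n))) (val t) ->
    supremums (range u) t.
  move=> [tub tlub]; split=> [_ [n _ <-]|b bub].
    by rewrite leEsub; apply: tub; exists n.
  rewrite leEsub; apply: tlub => _ [n _ <-].
  by rewrite -leEsub; apply: bub; exists n.
have lift_sup (u : nat -> H) : increasing_seq u ->
    exists t : H, supremums (range (fun n => val (u n))) (val t).
  move=> /val_incr uS; have [t tsup] := sc _ uS.
  have Ht : H t by exact: sH uS (fun n => HP (u n)) _ tsup.
  by exists (exist _ t (mem_set Ht)).
split; split.
- move=> a b; have [c [Hc ac bc]] := dirH _ _ (HP a) (HP b).
  by exists (exist _ c (mem_set Hc)); rewrite !leEsub.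
- by move=> u /lift_sup[t tsup]; exists t; exact: sup_H.
- by move=> a; exact: pr.
- by move=> a; have [] := skeleton_css sk (val a).
- move=> a b; rewrite leEsub => ab.
  by case: sk => _ [_ /(_ _ _ ab)].
- move=> u t uS tsup; have [t' t'sup] := lift_sup u uS.
  have <- : t' = t by exact: is_subset1_supremums (sup_H _ _ t'sup) tsup.
  exact: (skeleton_sup sk (val_incr _ uS) t'sup).
- apply/seteqP; split=> // x _; have [a Ha ax] := covH x.
  by exists (exist _ a (mem_set Ha)).
Qed.

(** * Coherent tuples of indices *)

Section CommonSkeleton.
Context {K : numFieldType} (arch : archimedean_norm K) {X : normedModType K}
  (nd : norming_dual X) {d : Order.disp_t} {G : nat -> porderType d}
  {s : forall n, G n -> X -> X}.
Arguments s : clear implicits.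
Hypothesis sk : forall n, projectional_skeleton (s n).
Hypothesis same_dual : forall n m, induced_set (s n) = induced_set (s m).

Definition le_seq (a b : forall n, G n) := forall n, (a n <= b n)%O.

Lemma le_seq_trans b a c : le_seq a b -> le_seq b c -> le_seq a c.
Proof. by move=> ab bc n; exact: le_trans (ab n) (bc n). Qed.

Lemma seq_sup (u : nat -> forall n, G n) : (forall i, le_seq (u i) (u i.+1)) ->
  exists p, forall n, supremums (range (fun i => u i n)) (p n).
Proof.
move=> uS.
have h n : exists p, supremums (range (fun i => u i n)) p.
  by have [[_ sc _] _] := sk n; apply: sc => i; exact: uS.
by exists (fun n => sval (cid (h n))) => n; exact: svalP (cid (h n)).
Qed.

(** Coordinatewise suprema exist by sigma-completeness, and antisymmetry identifies them with the
    coordinates of [p]. *)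
Lemma lub_seq_sup (u : nat -> forall n, G n) p :
  (forall i, le_seq (u i) (u i.+1)) -> lub le_seq (range u) p ->
  forall n, supremums (range (fun i => u i n)) (p n).
Proof.
move=> uS [pub plub] n; have [q qP] := seq_sup uS.
suff -> : p n = q n by [].
apply/le_anti; rewrite plub /=.
  by apply: (qP n).2 => _ [i _ <-]; apply: pub; exists i.
by move=> _ [i _ <-] m; apply: (qP m).1; exists i.
Qed.

Lemma seq_sup_lub (u : nat -> forall n, G n) p :
  (forall n, supremums (range (fun i => u i n)) (p n)) -> lub le_seq (range u) p.
Proof.
move=> pP; split=> [_ [i _ <-] n|q qub n]; first by apply: (pP n).1; exists i.
by apply: (pP n).2 => _ [i _ <-]; apply: qub; exists i.
Qed.

Context {N : nat -> nat}.
Hypothesis bounded_cofinal : forall n a,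
  exists2 t, (a <= t)%O & bounded_by (N n) (s n t).

(** The bounds [N n] are fixed beforehand because comparing projections at suprema requires one
    bound along the whole sequence. *)
Definition coherent (a : forall n, G n) :=
  (forall n, bounded_by (N n) (s n (a n))) /\ (forall n m, s n (a n) = s m (a m)).

(** The hypotheses link consecutive terms across skeletons, which covers both an interleaved
    construction and increasing coherent tuples. Interleaving equates the ranges; absorption then
    equates the projections. *)
Lemma coherent_sup (u : nat -> forall n, G n) p :
  (forall i n, bounded_by (N n) (s n (u i n))) ->
  (forall i, le_seq (u i) (u i.+1)) ->
  (forall i n m x, s n (u i n) (s m (u i.+1 m) x) = s n (u i n) x) ->
  (forall i n m, range (s n (u i n)) `<=` range (s m (u i.+1 m))) ->
  (forall n, supremums (range (fun i => u i n)) (p n)) -> coherent p.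
Proof.
move=> ub uS uc ur psup.
have incr n : increasing_seq (fun i => u i n) by move=> i; exact: uS.
split=> [n|n m]; first exact: (skeleton_sup_bounded (sk n) (incr n) (psup n)).
have sub k l : range (s k (p k)) `<=` range (s l (p l)).
  rewrite (skeleton_sup (sk k) (incr k) (psup k)).
  rewrite (skeleton_sup (sk l) (incr l) (psup l)).
  by apply: closureS => x [i _ xi]; exists i.+1 => //; exact: ur xi.
apply: (skeleton_sup_eq (sk n) (incr n) (psup n) _ (sk m)) => //.
  exact/seteqP.
(* [s n (u i n)] absorbs [s m (u i.+1 m)], which in turn absorbs [s m (p m)]. *)
move=> i x; rewrite -(uc i n m) (skeleton_compl (sk m)) ?uc //.
by apply: (psup m).1; exists i.+1.
Qed.

(** Each [b m] must exceed countably many thresholds from [skeleton_absorb], one for each [n]; since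
    these work for every larger index, a bounded one can be chosen above them. *)
Lemma absorb_step (a : forall n, G n) : exists b : forall n, G n,
  [/\ le_seq a b, forall n, bounded_by (N n) (s n (b n)),
    forall n m x, s n (a n) (s m (b m) x) = s n (a n) x &
    forall n m, range (s n (a n)) `<=` range (s m (b m))].
Proof.
have h m : exists b : G m, [/\ (a m <= b)%O, bounded_by (N m) (s m b) &
    forall n, (forall x, s n (a n) (s m b x) = s n (a n) x) /\
      range (s n (a n)) `<=` range (s m b)].
  have /choice[t tP] : forall n, exists t, forall t', (t <= t')%O ->
      (forall x, s n (a n) (s m t' x) = s n (a n) x) /\
      range (s n (a n)) `<=` range (s m t').
    move=> n; apply: skeleton_absorb => //.
    by rewrite (same_dual n m).
  have [c tc] := skeleton_ub (sk m) t.
  have [e [ae ce]] : exists e, (a m <= e)%O /\ (c <= e)%O.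
    by have [[dir _ _] _] := sk m; exact: dir.
  have [b eb bb] := bounded_cofinal e; exists b; split=> //.
    exact: le_trans ae eb.
  by move=> n; apply: tP; exact: le_trans (le_trans (tc n) ce) eb.
have hP m := svalP (cid (h m)).
exists (fun m => sval (cid (h m))); split=> [m|m|n m|n m].
- by have [] := hP m.
- by have [] := hP m.
- by have [_ _ /(_ n)[]] := hP m.
- by have [_ _ /(_ n)[]] := hP m.
Qed.

Lemma coherent_cofinal a : exists2 b, coherent b & le_seq a b.
Proof.
have [step stepP] := choice absorb_step.
(* The iteration starts at [step a], since [a] itself need not obey the norm bounds. *)
pose u := fix u i := if i is j.+1 then step (u j) else step a.
have uS i : le_seq (u i) (u i.+1) by have [] := stepP (u i).
have [p pP] := seq_sup uS; exists p.
  apply: (@coherent_sup u) => // [[|i] n|i n m x|i n m] /=.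
  - by have [] := stepP a.
  - by have [] := stepP (u i).
  - by have [_ _ ->] := stepP (u i).
  - by have [_ _ _] := stepP (u i).
apply: (@le_seq_trans (u 0%N)); first by have [] := stepP a.
by move=> n; apply: (pP n).1; exists 0%N.
Qed.

Lemma coherent_ub a b : exists c, [/\ coherent c, le_seq a c & le_seq b c].
Proof.
have h n : exists c, (a n <= c)%O /\ (b n <= c)%O.
  by have [[dir _ _] _] := sk n; exact: dir.
have [c cc lc] := coherent_cofinal (fun n => sval (cid (h n))).
exists c; split=> // n; apply: le_trans (lc n); by have [] := svalP (cid (h n)).
Qed.

(** Coherence lets the skeleton [m] be exchanged for [n], so the links required by [coherent_sup]
    reduce to compatibility inside one skeleton. *)
Lemma coherent_lub (u : nat -> forall n, G n) : (forall i, coherent (u i)) ->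
  (forall i, le_seq (u i) (u i.+1)) ->
  exists2 p, coherent p & lub le_seq (range u) p.
Proof.
move=> uc uS; have [p pP] := seq_sup uS.
exists p; last exact: seq_sup_lub.
apply: (@coherent_sup u) => // [i n|i n m x|i n m]; first exact: (uc i).1.
  by rewrite ((uc i.+1).2 m n) (skeleton_compl (sk n)) //; exact: uS.
by rewrite ((uc i).2 n m); apply: (skeleton_range_le (sk m)); exact: uS.
Qed.

End CommonSkeleton.

(** * Open sets meeting a given set *)

Section Hits.
Context {K : numFieldType} {X : normedModType K} {L : Type}.

Definition hits (U : L -> set X) (A : set X) : set L :=
  [set l | U l `&` A !=set0].

Lemma hits_sub (U : L -> set X) A B : A `<=` B -> hits U A `<=` hits U B.
Proof. by move=> AB l [x [Ux /AB Bx]]; exists x. Qed.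

Lemma hits_closure_bigcup (U : L -> set X) (A : nat -> set X) :
  (forall l, open (U l)) ->
  hits U (closure (\bigcup_i A i)) = \bigcup_i hits U (A i).
Proof.
move=> Uo; apply/seteqP; split=> l.
  move=> [x [Ux /(_ (U l)) []]]; first exact: open_nbhs_nbhs.
  by move=> y [[i _ Ay] Uy]; exists i => //; exists y.
move=> [i _ [x [Ux Ax]]]; exists x; split=> //.
by apply: subset_closure; exists i.
Qed.

Lemma countable_hits (U : L -> set X) A : (forall l, open (U l)) ->
  (forall x, countable [set l | U l x]) -> separable_set A -> countable (hits U A).
Proof.
move=> Uo Uc [C [cC _ AC]].
apply: (@sub_countable _ _ _ (\bigcup_(c in C) [set l | U l c])).
  apply: subset_card_le => l [x [Ux /AC /(_ (U l))[]]].
    exact: open_nbhs_nbhs.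
  by move=> c [Cc Uc']; exists c.
exact: bigcup_countable.
Qed.

End Hits.

(** * Construction of the simple skeleton *)

Section CommonSubskeleton.
Context {K : numFieldType} (arch : archimedean_norm K) {X : normedModType K}
  (nd : norming_dual X) {d : Order.disp_t} {G : nat -> porderType d}
  {s : forall n, G n -> X -> X}.
Arguments s : clear implicits.
Hypothesis sk : forall n, projectional_skeleton (s n).
Hypothesis same_dual : forall n m, induced_set (s n) = induced_set (s m).

(** [psi A] applies the map of [sigma_continuous_map] to the labels met by [A], each label being
    sent to a tuple whose ranges contain its centre. *)
Lemma sigma_continuous_choice : exists psi : set X -> forall n, G n,
  [/\ forall A, separable_set A -> A !=set0 ->
        forall n m, s n (psi A n) = s m (psi A m),
    forall A B, separable_set A -> separable_set B -> A !=set0 -> A `<=` B ->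
        forall n, (psi A n <= psi B n)%O,
    forall A n, separable_set A -> A `<=` range (s n (psi A n)) &
    forall A : nat -> set X, (forall i, separable_set (A i)) -> A 0%N !=set0 ->
      (forall i, A i `<=` A i.+1) -> forall n,
      supremums (range (fun i => psi (A i) n)) (psi (closure (\bigcup_i A i)) n)].
Proof.
have [N bcof] := choice (fun n => skeleton_bounded_cofinal (sk n) arch).
have [U [Uo Uc Ux]] := @sigma_disjoint_cover _ arch X.
have cov (x : X) : exists a : forall n, G n, forall n, range (s n (a n)) x.
  have h n := skeleton_cover (sk n) x.
  by exists (fun n => sval (cid (h n))) => n; exact: svalP (cid (h n)).
have [a aP] := choice cov.
have [Phi [Phi_good Phi_le Phi_g Phi_lub]] := @sigma_continuous_map _ _ _ _
  (@le_seq_trans d G)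
  (coherent_ub nd sk same_dual bcof) (coherent_lub sk)
  (fun l : nat * nat * X => a l.2) (a 0).
have cnt A : separable_set A -> countable (hits U A) by exact: countable_hits.
have ne A : A !=set0 -> hits U A !=set0.
  by move=> [x Ax]; have [l Ul _] := Ux x 1 ltr01; exists l, x.
exists (fun A => Phi (hits U A)); split.
- move=> A sA A0 n m; exact: (Phi_good _ (cnt A sA) (ne A A0)).2.
- move=> A B sA sB A0 AB; apply: Phi_le; [exact: cnt|exact: cnt|exact: ne|].
  exact: hits_sub.
(* Points of [A] are limits of centres of open sets that meet [A], and these centres lie in the
   closed range. *)
- move=> A n sA x Ax; apply: closed_normP; first exact: skeleton_closed.
  move=> e e0; have [l Ul le] := Ux x e e0; exists l.2 => //.
  apply: (skeleton_range_le (sk n) _ (aP l.2 n)).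
  by apply: Phi_g; [exact: cnt|exists x].
- move=> A sA A0 AS n; rewrite hits_closure_bigcup //.
  have hS i : hits U (A i) `<=` hits U (A i.+1) by exact: hits_sub.
  apply: (@lub_seq_sup _ _ _ _ _ sk (fun i => Phi (hits U (A i)))).
    move=> i; apply: Phi_le; [exact: cnt|exact: cnt| |exact: hS].
    by apply: ne; case: A0 => x /(increasing_seq_sub AS (leq0n i)); exists x.
  by apply: Phi_lub => //; [move=> i; exact: cnt|exact: ne].
Qed.

Lemma common_simple_subskeleton : exists (F : set (set X)) (P : F -> X -> X),
  simple_projectional_skeleton P /\
  forall n, exists H : set (G n),
    subskeleton (s n) H /\ isomorphic_skeletons P (subfamily (s n) H).
Proof.
have [psi [psi_eq psi_le psi_range psi_sup]] := sigma_continuous_choice.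
(* Coordinate [0] is an arbitrary choice, as [psi_eq] makes all coordinates give the same
   projection. *)
pose F : set (set X) := [set Y | closed_separable_subspace Y /\
  range (s 0%N (psi Y 0%N)) = Y].
have css_sep (Y : set X) : closed_separable_subspace Y -> separable_set Y by case.
have css_ne (Y : set X) : closed_separable_subspace Y -> Y !=set0.
  by case=> -[Y0 _] _ _; exists 0; move: Y0; rewrite in_setE.
have sup_range (Y : nat -> set X) n : (forall i, closed_separable_subspace (Y i)) ->
    (forall i, Y i `<=` Y i.+1) ->
    range (s n (psi (closure (\bigcup_i Y i)) n)) =
    closure (\bigcup_i range (s n (psi (Y i) n))).
  move=> cY YS; have sY i := css_sep _ (cY i).
  apply: (skeleton_sup (sk n) (u := fun i => psi (Y i) n)); last first.
    by apply: psi_sup => //; exact: css_ne.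
  by move=> i; apply: psi_le => //; exact: css_ne.
have F_sup (Y : nat -> set X) : (forall i, F (Y i)) ->
    (forall i, Y i `<=` Y i.+1) -> F (closure (\bigcup_i Y i)).
  move=> FY YS; have E : range (s 0%N (psi (closure (\bigcup_i Y i)) 0%N)) =
      closure (\bigcup_i Y i).
    rewrite sup_range //; last by move=> i; have [] := FY i.
    by congr closure; apply: eq_bigcupr => i _; have [] := FY i.
  by split=> //; rewrite -E; exact: skeleton_css.
have F_cof (Y : set X) : closed_separable_subspace Y -> exists2 Z, F Z & Y `<=` Z.
  move=> cY.
  (* Iterating the range map yields a union whose closure it fixes: by [sup_range] the new range
     comes from the shifted sequence [Z i.+1], which has the same union. *)
  pose Z := fix Z i := if i is j.+1 then range (s 0%N (psi (Z j) 0%N)) else Y.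
  have cZ i : closed_separable_subspace (Z i).
    by case: i => //= i; exact: skeleton_css.
  have ZS i : Z i `<=` Z i.+1 by apply: psi_range; exact: css_sep.
  exists (closure (\bigcup_i Z i)); last first.
    by move=> y Yy; apply: subset_closure; exists 0%N.
  have E : range (s 0%N (psi (closure (\bigcup_i Z i)) 0%N)) =
      closure (\bigcup_i Z i).
    rewrite sup_range //; apply/seteqP; split; apply: closureS => x [i _ xi].
      by exists i.+1.
    by exists i => //; exact: ZS xi.
  by split=> //; rewrite -E; exact: skeleton_css.
have F_eq Y n : F Y -> s n (psi Y n) = s 0%N (psi Y 0%N).
  by move=> [cY _]; apply: psi_eq; [exact: css_sep|exact: css_ne].
have F_range Y n : F Y -> range (s n (psi Y n)) = Y.
  by move=> FY; rewrite F_eq //; have [] := FY.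
have F_le Y Z n : F Y -> F Z -> (psi Y n <= psi Z n)%O <-> Y `<=` Z.
  move=> FY FZ; split=> [/(skeleton_range_le (sk n))|YZ]; first by rewrite !F_range.
  have [cY _] := FY; have [cZ _] := FZ.
  by apply: psi_le => //; [exact: css_sep|exact: css_sep|exact: css_ne].
have FV (E : F) : F (val E) by exact: set_valP.
exists F, (fun E => s 0%N (psi (val E) 0%N)); split.
  split=> [|E|E|E E' EE'].
  - by split=> // Y [].
  - by have [[_ _ pr] _] := sk 0%N; exact: pr.
  - exact: F_range.
  - have [_ [_ + _ _]] := sk 0%N; apply; exact/F_le.
move=> n; pose H : set (G n) := [set psi Y n | Y in F].
exists H; split.
  apply: subskeleton_suff => //.
  - move=> u uS uH t tsup.
    have /choice[Y YP] : forall i, exists Y, F Y /\ psi Y n = u i.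
      by move=> i; have [Y FY Yu] := uH i; exists Y.
    have FY i : F (Y i) by exact: (YP i).1.
    have cY i : closed_separable_subspace (Y i) by exact: (FY i).1.
    have YS i : Y i `<=` Y i.+1.
      by apply/(F_le _ _ n) => //; rewrite !(YP _).2; exact: uS.
    exists (closure (\bigcup_i Y i)); first exact: F_sup.
    apply: is_subset1_supremums tsup.
    have -> : u = (fun i => psi (Y i) n) by apply/funext => i; rewrite (YP i).2.
    by apply: psi_sup => // [i|]; [exact: css_sep|exact: css_ne].
  - move=> _ _ [Y FY <-] [Z FZ <-].
    have [[dir _ _] _] := sk n.
    have [c [Yc Zc]] := dir (psi Y n) (psi Z n).
    (* The bound [c] may lie outside [H]; enlarging its range to a member [V] of [F] brings the
       comparison back to inclusions. *)
    have [V FVV cV] := F_cof _ (skeleton_css (sk n) c).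
    exists (psi V n); split; first by exists V.
      apply/F_le => //; apply: subset_trans cV.
      by rewrite -(F_range Y n FY); exact: skeleton_range_le.
    apply/F_le => //; apply: subset_trans cV.
    by rewrite -(F_range Z n FZ); exact: skeleton_range_le.
  - move=> x; have [c xc] := skeleton_cover (sk n) x.
    have [V FVV cV] := F_cof _ (skeleton_css (sk n) c).
    by exists (psi V n); [exists V|rewrite F_range //; exact: cV].
have HP (E : F) : H (psi (val E) n) by exists (val E).
pose phi (E : F) : H := exist _ (psi (val E) n) (mem_set (HP E)).
have phi_le E E' : (phi E <= phi E')%O <-> (E <= E')%O.
  rewrite !leEsub subsetEset; exact: F_le.
have phi_inj : injective phi.
  move=> E E' EE'; apply/le_anti.
  by apply/andP; split; apply/phi_le; rewrite EE'.
exists phi; last by move=> E; exact/esym/F_eq.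
split=> //; have /choice[g gP] : forall h : H, exists E, phi E = h.
  move=> h; have [Y FY Yh] := set_valP h.
  by exists (exist _ Y (mem_set FY)); apply: val_inj.
by exists g => // E; apply: phi_inj.
Qed.

End CommonSubskeleton.

Theorem theorem3 (R : realType) (k : scalars)
    (X : completeNormedModType (scalar_field R k))
    (d : Order.disp_t) (Gamma : nat -> porderType d)
    (s : forall n : nat, Gamma n -> X -> X)
    (D : set (X -> (scalar_field R k)^o)) :
  (forall n : nat, projectional_skeleton (s n)) ->
  (forall n : nat, induced_set (s n) = D) ->
  exists (F : set (set X)) (P : F -> X -> X),
    simple_projectional_skeleton P /\
    forall n : nat, exists H : set (Gamma n),
      subskeleton (s n) H /\
      isomorphic_skeletons P (subfamily (s n) H).
Proof.
move=> sk sD; apply: common_simple_subskeleton => //.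
- exact: archimedean_scalar.
- exact: norming_dual_scalar.
- by move=> n m; rewrite !sD.
Qed.
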